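(* Let $\ell:\mathbb{R}\to\mathbb{R}$ be second-order differentiable, with lower bound $0$, and let the interval $(p^{[a]},p^{[b]})$ be a local M region for $\ell$ with extreme points $(p^{[\min]},\ell(p^{[\min]}))$, $(p^{[\max_1]},\ell(p^{[\max_1]}))$ and $(p^{[\max_2]},\ell(p^{[\max_2]}))$, where $p^{[\max_1]}<p^{[\max_2]}$. Let $\delta$ be a vertical deformation mapping, let $\eta$ be the learning rate, and let the parameter be updated by gradient descent equipped with $\delta$, i.e. $$p^{(k+1)}=p^{(k)}-\eta\,\nabla\delta\big(\ell(p^{(k)})\big),$$ with initial position in $(p^{[\max_1]},p^{[\max_2]})$. Let $\triangle p^{[\max]}=p^{[\max_2]}-p^{[\max_1]}$, and let the total number of steps $\tilde k$ be sufficiently large. If $p^{(k+1)}$ remains in the V part $(p^{[\max_1]},p^{[\max_2]})$ (that is, the iterate lies in the V part at step $k$ and still lies in it at step $k+1$), then the derivative of $\ell$ at $p^{(k)}$ is bounded by $$\left|\frac{\partial \ell(p^{(k)})}{\partial p^{(k)}}\right|\le\frac{\triangle p^{[\max]}}{\eta\,\frac{\partial\delta}{\partial\ell}},$$ where $\frac{\partial\delta}{\partial\ell}$ is evaluated at $\ell(p^{(k)})$.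
   Context: Local M region: let $f:\mathbb{R}\to\mathbb{R}$ be second-order differentiable on an interval $(x^{[a]},x^{[b]})$. Suppose that within this interval $f$ has exactly three extreme points, $(x^{[\min]},f(x^{[\min]}))$, $(x^{[\max_1]},f(x^{[\max_1]}))$ and $(x^{[\max_2]},f(x^{[\max_2]}))$, with $f''(x^{[\min]})>0$, $f''(x^{[\max_1]})<0$, $f''(x^{[\max_2]})<0$ and $x^{[\max_1]}<x^{[\max_2]}$. Then $(x^{[a]},x^{[b]})$ is called a local concave region, or local M region, for $f$, and the interval $(x^{[\max_1]},x^{[\max_2]})$ is called the V part of the local M region. Vertical deformation mapping (VDM), in one parameter dimension: a mapping that leaves the parameter $p$ unchanged and replaces the loss value $\ell$ by $\check\ell=\delta(\ell)$, such that the derivative of the deformed loss $p\mapsto\delta(\ell(p))$ exists at every $p$, and such that for all $\ell\ge 0$ the derivative $\frac{\partial\delta}{\partial\ell}$ exists and satisfies $\frac{\partial\delta}{\partial\ell}\ge 0$. Here $p^{(k)}$ denotes the parameter at step $k$, $\nabla\delta(\ell(p^{(k)}))$ denotes the derivative with respect to $p$ of $p\mapsto\delta(\ell(p))$ at $p^{(k)}$, $\frac{\partial \ell(p^{(k)})}{\partial p^{(k)}}$ denotes $\ell'(p^{(k)})$, $\tilde k$ denotes the total number of steps, and $\eta$ is the learning rate (step size) of gradient descent, a positive number. *)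

(* Defs.v *)
From mathcomp Require Import all_boot all_order all_algebra.
From mathcomp Require Import all_classical all_reals all_analysis.
Set Implicit Arguments.
Unset Strict Implicit.
Unset Printing Implicit Defensive.
Import Order.TTheory GRing.Theory Num.Theory.
Import numFieldNormedType.Exports.
Local Open Scope ring_scope.
Local Open Scope classical_set_scope.

Definition twice_derivable_on (R : realType) (f : R -> R) (A : set R) : Prop :=
  forall x, A x -> derivable f x 1 /\ derivable f^`() x 1.

Definition extreme_point (R : realType) (f : R -> R) (x : R) : Prop :=
  (\forall y \near x, f x <= f y) \/ (\forall y \near x, f y <= f x).

(* The three extreme points are pairwise distinct because of the signs of f''
   and xmax1 < xmax2; xmin is not assumed to lie between the two maxima. *)
Definition local_M_region (R : realType) (f : R -> R)
    (a b xmin xmax1 xmax2 : R) : Prop :=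
  [/\ twice_derivable_on f `]a, b[,
      `]a, b[ `&` extreme_point f = [set xmin; xmax1; xmax2],
      0 < f^`(2) xmin,
      f^`(2) xmax1 < 0 /\ f^`(2) xmax2 < 0
    & xmax1 < xmax2].

Definition V_part (R : realType) (xmax1 xmax2 : R) : set R := `]xmax1, xmax2[.

(* The mapping (p, l) |-> (p, delta l) is represented by delta alone.  The
   derivative of delta at l = 0 is two-sided. *)
Definition vertical_deformation (R : realType) (loss delta : R -> R) : Prop :=
  (forall p : R, derivable (delta \o loss) p 1) /\
  (forall l : R, 0 <= l -> derivable delta l 1 /\ 0 <= delta^`() l).

Definition gradient_descent (R : realType) (eta : R) (g : R -> R)
    (p : nat -> R) : Prop :=
  forall k, p k.+1 = p k - eta * derive1 g (p k).

(* Main.v *)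
Require Import Defs.
From mathcomp Require Import all_boot all_order all_algebra.
From mathcomp Require Import all_classical all_reals all_analysis.
From mathcomp Require Import lra.
Import Order.TTheory GRing.Theory Num.Theory.
Import numFieldNormedType.Exports.
Local Open Scope ring_scope.
Local Open Scope classical_set_scope.

(** By the chain rule one step moves the parameter by [eta * (d * l)] in absolute value, with [d]
    and [l] the derivatives of [delta] and [loss]. Two points of the V part are less than its width
    apart, so dividing by [eta * d] gives the bound. *)

(* The bound is a quotient of extended reals, so that it is the real quotient
   when the derivative of delta is nonzero and +oo when it vanishes. *)
Theorem theorem2 (R : realType) (loss delta : R -> R)
    (pa pb pmin pmax1 pmax2 eta : R) (p : nat -> R)
    (loss_diff : twice_derivable_on loss setT)
    (loss_ge0 : forall x : R, 0 <= loss x)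
    (region : local_M_region loss pa pb pmin pmax1 pmax2)
    (vdm : vertical_deformation loss delta)
    (eta_gt0 : 0 < eta)
    (gd : gradient_descent eta (delta \o loss) p)
    (p_init : V_part pmax1 pmax2 (p 0%N)) :
  \forall ktot \near \oo, forall k : nat, (k < ktot)%N ->
    V_part pmax1 pmax2 (p k) -> V_part pmax1 pmax2 (p k.+1) ->
    (`|derive1 loss (p k)|%:E <=
       (pmax2 - pmax1)%:E / (eta * derive1 delta (loss (p k)))%:E)%E.
Proof.
apply: nearW => _ k _; rewrite /V_part /= !in_itv /= => /andP[lo hi] /andP[lo' hi'].
have [_ /(_ _ (loss_ge0 (p k)))[ddelta d_ge0]] := vdm.
have [dloss _] := loss_diff (p k) I.
set d := derive1 delta _ in d_ge0 *; set l := derive1 loss _.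
(* The chain rule applies because [loss (p k)] is nonnegative, where [delta] is derivable. *)
have step : p k.+1 = p k - eta * (d * l) by rewrite gd derive1_comp.
have width_gt0 : 0 < pmax2 - pmax1 by lra.
have [d0|d_neq0] := eqVneq d 0.
  (* The inverse of 0 is [+oo], and a positive width times [+oo] is [+oo]. *)
  by rewrite d0 mulr0 inve0 gt0_muley ?lte_fin// leey.
have d_gt0 : 0 < d by rewrite lt0r d_neq0.
have ed_gt0 : 0 < eta * d by rewrite mulr_gt0.
rewrite inver (gt_eqF ed_gt0) -EFinM lee_fin ler_pdivlMr// mulrC.
(* The goal becomes a bound on the absolute value of [eta * (d * l)], which is [p k - p k.+1] by
   [step]. *)
by rewrite -(gtr0_norm ed_gt0) -normrM -mulrA ler_norml; lra.
Qed.
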